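(* For any connected graph $G$, $pd_s(G)\le dim_s(G)+1$.
   Context: All graphs are finite, simple and connected; $d_G(x,y)$ is the shortest-path distance. A vertex $v$ strongly resolves two different vertices $x,y$ if $d_G(x,v)=d_G(x,y)+d_G(y,v)$ or $d_G(y,v)=d_G(y,x)+d_G(x,v)$. A set $S\subseteq V(G)$ is a strong resolving set if every two vertices of $G$ are strongly resolved by some vertex of $S$; the strong metric dimension $dim_s(G)$ is the minimum cardinality of a strong resolving set. For $x\in V(G)$ and $W\subseteq V(G)$, $d_G(x,W)=\min\{d_G(x,w):w\in W\}$. A set $W$ strongly resolves two different vertices $x,y\notin W$ if $d_G(x,W)=d_G(x,y)+d_G(y,W)$ or $d_G(y,W)=d_G(y,x)+d_G(x,W)$. An ordered vertex partition $\Pi=\{U_1,\dots,U_k\}$ of $G$ is a strong resolving partition if every two different vertices of $G$ belonging to the same set of $\Pi$ are strongly resolved by some set of $\Pi$. The strong partition dimension $pd_s(G)$ is the minimum cardinality of a strong resolving partition of $G$. *)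

(* Defs.v *)
(* A simple graph is a symmetric irreflexive relation [e : rel T] on
   a finType [T] of vertices; it is connected when all pairs are in [connect e]. *)
From mathcomp Require Import all_boot.

Set Implicit Arguments.
Unset Strict Implicit.
Unset Printing Implicit Defensive.

Section StrongResolvability.

Variables (T : finType) (e : rel T).
Implicit Types (x y v w : T) (S W : {set T}) (P : {set {set T}}).

Definition has_walk n x y :=
  [exists p : n.-tuple T, path e x p && (last x p == y)].

(* A shortest path has fewer than #|T| edges, so searching 0, ..., #|T| - 1
   suffices; the value is the junk #|T| when y is not reachable from x. *)
Definition dist x y : nat := find (fun n => has_walk n x y) (iota 0 #|T|).

(* The default #|T| exceeds every distance of a connected graph, so this is the
   minimum as soon as W is nonempty. *)
Definition dist_set x W : nat := \big[minn/#|T|]_(w in W) dist x w.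

Definition vertex_strongly_resolves v x y :=
  (dist x v == dist x y + dist y v) || (dist y v == dist y x + dist x v).

Definition strong_resolving_set S :=
  [forall x, forall y,
    (x != y) ==> [exists v in S, vertex_strongly_resolves v x y]].

Definition set_strongly_resolves W x y :=
  [&& x \notin W, y \notin W &
      (dist_set x W == dist x y + dist_set y W)
   || (dist_set y W == dist y x + dist_set x W)].

(* The order of the blocks of a partition is immaterial for this property and
   for the number of blocks, hence unordered partitions. *)
Definition strong_resolving_partition P :=
  partition P [set: T] &&
  [forall U in P, forall x in U, forall y in U,
    (x != y) ==> [exists W in P, set_strongly_resolves W x y]].

Definition singletons : {set {set T}} := [set [set x] | x : T].

(* The seeds [set: T] and [singletons] of the two minima are admissible: see
   strong_resolving_setT and strong_resolving_singletons. *)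
Definition dim_s : nat :=
  #|[arg min_(S < [set: T] | strong_resolving_set S) #|S|]|.

Definition pd_s : nat :=
  #|[arg min_(P < singletons | strong_resolving_partition P) #|P|]|.

Lemma has_walkP n x y :
  reflect (exists p, [/\ path e x p, last x p = y & size p = n])
          (has_walk n x y).
Proof.
apply: (iffP existsP) => [[p /andP[ep /eqP py]]|[p [ep py pn]]].
  by exists p; rewrite size_tuple.
by exists (tcast pn (in_tuple p)); rewrite val_tcast /= ep py eqxx.
Qed.

Lemma dist_min p x : path e x p -> dist x (last x p) <= size p.
Proof.
move=> ep; have [pT|pT] := ltnP (size p) #|T|; last first.
  by rewrite (leq_trans _ pT) // (leq_trans (find_size _ _)) // size_iota.
rewrite leqNgt; apply/negP => /(before_find 0); rewrite nth_iota // add0n.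
by move/has_walkP; apply; exists p.
Qed.

Lemma dist_lt x y : connect e x y -> dist x y < #|T|.
Proof.
case/connectP => p /shortenP[q eq uq _] ->.
apply: leq_ltn_trans (dist_min eq) _.
by rewrite -[_ < _]/(size (x :: q) <= _) -(card_uniqP uq) max_card.
Qed.

Lemma dist_path x y : connect e x y ->
  exists p, [/\ path e x p, last x p = y & size p = dist x y].
Proof.
move=> /dist_lt d_lt; apply/has_walkP.
have xy : has (fun n => has_walk n x y) (iota 0 #|T|) by rewrite has_find size_iota.
by have := nth_find 0 xy; rewrite nth_iota.
Qed.

Lemma dist_setP x W : (forall y, connect e x y) -> W != set0 ->
  (exists2 w, w \in W & dist_set x W = dist x w)
  /\ (forall w, w \in W -> dist_set x W <= dist x w).
Proof.
move=> ex /set0Pn[w0 w0W].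
have le_min w : w \in W -> dist_set x W <= dist x w.
  rewrite /dist_set; elim: (index_enum T) (mem_index_enum w) => // z r IHr.
  rewrite inE big_cons => /predU1P[<- ->|/IHr{}IHr wW]; first exact: geq_minl.
  by case: ifP => _; last exact: IHr; rewrite (leq_trans (geq_minr _ _)) ?IHr.
split=> //; suff: dist_set x W = #|T| \/
    exists2 w, w \in W & dist_set x W = dist x w.
  by case=> // dT; move: (le_min _ w0W); rewrite dT leqNgt dist_lt.
apply: (big_ind (fun d => d = #|T| \/ exists2 w, w \in W & d = dist x w)).
- by left.
- by move=> d1 d2 d1P d2P; rewrite /minn; case: ifP.
- by move=> w wW; right; exists w.
Qed.

Lemma distxx x : dist x x = 0.
Proof. by apply/eqP; rewrite -leqn0; apply: (@dist_min [::]). Qed.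

Lemma strong_resolving_setT : strong_resolving_set [set: T].
Proof.
apply/'forall_forallP => x y; apply/implyP => _; apply/existsP; exists x.
by rewrite inE /vertex_strongly_resolves distxx addn0 eqxx orbT.
Qed.

Lemma strong_resolving_singletons : strong_resolving_partition singletons.
Proof.
apply/andP; split.
  apply/and3P; split.
  - apply/eqP/setP => x; rewrite inE; apply/bigcupP.
    by exists [set x]; rewrite ?set11 ?imset_f.
  - apply/trivIsetP => _ _ /imsetP[x _ ->] /imsetP[y _ ->] xy.
    by rewrite disjoints1 inE; apply: contraNneq xy => ->.
  - by apply/imsetP => -[x _ /setP/(_ x)]; rewrite !inE eqxx.
apply/'forall_implyP => _ /imsetP[z _ ->]; apply/'forall_implyP => x /set1P ->.
by apply/'forall_implyP => y /set1P ->; rewrite eqxx.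
Qed.

End StrongResolvability.

(* Main.v *)
(* If S is a strong resolving set, split the vertices into the singletons of S
   together with the complement of S, when nonempty. Two distinct vertices of
   the same block both lie outside S, so the vertex v of S resolving them gives
   the resolving block [set v]. *)
Require Import Defs.
From mathcomp Require Import all_boot.

(** Makes resolution by the block [[set v]] the same distance condition as resolution by the vertex
    [v]. *)
Lemma dist_set1 (T : finType) (e : rel T) (x v : T) :
  (forall y, connect e x y) -> dist_set e x [set v] = dist e x v.
Proof.
move=> ex; have [|[w /set1P -> ->] //] := @dist_setP _ e x [set v] ex.
by apply/set0Pn; exists v; rewrite set11.
Qed.

(** Removing [set0] matters when [S] is all of [T]: the complement is then empty, and a partition
    has no empty block. *)
Definition singletons_compl (T : finType) (S : {set T}) : {set {set T}} :=
  (~: S |: [set [set x] | x in S]) :\ set0.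

Lemma card_singletons_compl (T : finType) (S : {set T}) :
  #|singletons_compl T S| <= #|S|.+1.
Proof.
rewrite (leq_trans (subset_leq_card (subD1set _ _))) // cardsU1.
by rewrite -add1n leq_add ?leq_b1 ?leq_imset_card.
Qed.

Lemma set1_singletons_compl (T : finType) (S : {set T}) (x : T) :
  x \in S -> [set x] \in singletons_compl T S.
Proof.
move=> xS; rewrite !inE imset_f // orbT andbT.
by apply/set0Pn; exists x; rewrite set11.
Qed.

Lemma partition_singletons_compl (T : finType) (S : {set T}) :
  partition (singletons_compl T S) [set: T].
Proof.
apply/and3P; split; last by rewrite !inE eqxx.
- apply/eqP/setP => x; rewrite inE; apply/bigcupP.
  have [xS | xNS] := boolP (x \in S).
    by exists [set x]; rewrite ?set11 ?set1_singletons_compl.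
  exists (~: S); rewrite !inE ?eqxx ?andbT //.
  by apply/set0Pn; exists x; rewrite inE.
- have disj1C x : x \in S -> [disjoint [set x] & ~: S].
    by move=> xS; rewrite disjoints1 inE negbK.
  apply/trivIsetP => A B /setD1P[_ /setU1P[->|/imsetP[x xS ->]]].
    move=> /setD1P[_ /setU1P[->|/imsetP[y yS ->]]]; first by rewrite eqxx.
    by rewrite disjoint_sym disj1C.
  move=> /setD1P[_ /setU1P[->|/imsetP[y yS ->]]] xy; first exact: disj1C.
  by rewrite disjoints1 inE; apply: contraNneq xy => ->.
Qed.

Lemma strong_resolving_singletons_compl (T : finType) (e : rel T) (S : {set T}) :
    (forall x y, connect e x y) -> strong_resolving_set e S ->
  strong_resolving_partition e (singletons_compl T S).
Proof.
move=> e_conn /'forall_forallP resS.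
rewrite /strong_resolving_partition partition_singletons_compl /=.
apply/'forall_implyP => U /setD1P[_ /setU1P[->|/imsetP[z _ ->]]].
  apply/'forall_implyP => x; rewrite inE => xNS.
  apply/'forall_implyP => y; rewrite inE => yNS.
  apply/implyP => xy; have /existsP[v /andP[vS res_v]] := implyP (resS x y) xy.
  apply/existsP; exists [set v]; rewrite set1_singletons_compl //=.
  rewrite /set_strongly_resolves !dist_set1 // !inE.
  (* The distance condition is now [res_v]. The block must also avoid [x] and [y], which holds since
     [v] is in [S] and they are not. *)
  apply/and3P; split=> //.
  - by apply: contraNneq xNS => ->.
  - by apply: contraNneq yNS => ->.
(* A singleton block has no two distinct vertices to resolve. *)
apply/'forall_implyP => x /set1P ->; apply/'forall_implyP => y /set1P ->.
by rewrite eqxx.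
Qed.

Theorem theorem2 (T : finType) (e : rel T)
    (e_sym : symmetric e) (e_irr : irreflexive e)
    (e_conn : forall x y : T, connect e x y) :
  pd_s e <= dim_s e + 1.
Proof.
rewrite addn1 /dim_s; case: arg_minnP => [|S resS _].
  exact: strong_resolving_setT.
(* [S] attains [dim_s] and [P] attains [pd_s]; minimality of [P] is used against the partition built
   from [S]. *)
rewrite /pd_s; case: arg_minnP => [|P _ minP].
  exact: strong_resolving_singletons.
apply: leq_trans (card_singletons_compl T S).
exact/minP/strong_resolving_singletons_compl.
Qed.
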